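(* Consider the linear model $Y = X\beta^{0} + \epsilon$ with a fixed design matrix $X\in\mathbb{R}^{n\times p}$, unknown $\beta^{0}\in\mathbb{R}^{p}$, and Gaussian noise $\epsilon\sim\mathcal{N}_{n}(0,\sigma_{0}^{2}I)$. Let $\Omega$ be a norm on $\mathbb{R}^{p}$, $\lambda>0$, and let $\hat\beta$ be a minimizer of $\beta\mapsto \|Y-X\beta\|_{n}^{2}+\lambda\Omega(\beta)$. Fix $J\subset\{1,\dots,p\}$ and $\lambda_J>0$, let $g$ be the gauge norm and $\Psi$ the matrix norm described in the context, and let $\hat B_J\in\mathbb{R}^{|J^{c}|\times|J|}$ be a minimizer of $$B\mapsto \|X_J - X_{J^{c}}B\|_{nuc} + \lambda_J\Psi(B).$$ Put $R:=X_J-X_{J^{c}}\hat B_J$ and assume $\|R\|_{nuc}\neq 0$, that $\hat\Sigma_J:=R^{T}R/n$ is non-singular and that $T_J:=R^{T}X_J/n$ is invertible. Define $M:=\sqrt{n}\,\hat\Sigma_J^{-1/2}T_J$ and $$\hat b_J:=\hat\beta_J + T_J^{-1}R^{T}(Y-X\hat\beta)/n .$$ Let $S_\star$ be an allowed set of $\Omega$ (in the paper, the oracle set of a sharp oracle inequality). Then $$M(\hat b_J-\beta^{0}_J)/\sigma_0 = W + rem,$$ where $W\sim\mathcal{N}_{|J|}(0,I)$ and the remainder satisfies $$\|rem\|_{\infty}\le \sqrt{n}\,\lambda_J\, g(\hat\beta_{J^{c}}-\beta^{0}_{J^{c}})/\sigma_0 \le \sqrt{n}\,\lambda_J\,\Upsilon_{S_\star}(\hat\beta-\beta^{0})/\sigma_0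 .$$
   Context: For $v\in\mathbb{R}^{n}$, $\|v\|_n^2:=\sum_{j=1}^n v_j^2/n$. For $J\subset\{1,\dots,p\}$ and $\beta\in\mathbb{R}^p$, $\beta_J$ denotes either the vector $(\beta_j)_{j\in J}$ or the vector in $\mathbb{R}^p$ with entries $\beta_j 1\{j\in J\}$, depending on context; $X_J$ is the submatrix of columns in $J$. The nuclear norm of a matrix $A$ is $\|A\|_{nuc}=\mathrm{tr}(\sqrt{A^{T}A})$, the sum of its singular values. A set $S\subset\{1,\dots,p\}$ is called allowed (for $\Omega$) if there is a norm $\Omega^{S^{c}}$ on $\mathbb{R}^{|S^{c}|}$ with $\Omega(\beta_S)+\Omega^{S^{c}}(\beta_{S^{c}})\le\Omega(\beta)$ for all $\beta\in\mathbb{R}^p$ (weak decomposability); for each allowed $S$ such a norm $\Omega^{S^c}$ is fixed and $\Upsilon_S(\beta):=\Omega(\beta_S)+\Omega^{S^{c}}(\beta_{S^{c}})$. For $\beta\in\mathbb{R}^p$ let $\beta_{f(J)}:=\beta_J-\beta_{J^{c}}$, and for $B\subset\mathbb{R}^p$ let $\mathrm{flip}_J(B):=\{\beta_{f(J)}:\beta\in B\}$. Let $\overline{B}:=\bigcup_{S\text{ allowed}}\{\beta:\Upsilon_S(\beta)\le 1\}$, $B_g:=\mathrm{Conv}(\overline{B}\cup\mathrm{flip}_J(\overline{B}))$, and let $g(x):=\inf\{t>0: x\in tB_g\}$ be its gauge. For $A\in\mathbb{R}^{|J^{c}|\times|J|}$ let $A_j\in\mathbb{R}^p$ be the $j$-th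 column of $A$ placed on the coordinates $J^{c}$ and zero on $J$, and $\Psi(A):=\sum_{j=1}^{|J|}g(A_j)$. *)

(* Defs.v *)
From HB Require Import structures.
From mathcomp Require Import all_boot all_order all_algebra.
From mathcomp Require Import all_classical all_reals all_analysis.
Set Implicit Arguments. Unset Strict Implicit. Unset Printing Implicit Defensive.
Import Order.TTheory GRing.Theory Num.Theory.
Local Open Scope classical_set_scope.
Local Open Scope ring_scope.

Section Defs.
Variable R : realType.

Definition gauss_law (v : R) (A : set R) : \bar R :=
  if v == 0 then (\1_A (0 : R))%:E else normal_prob 0 (Num.sqrt v) A.

Definition has_gauss_law d (T : measurableType d) (P : probability T R)
  (Z : T -> R) (v : R) : Prop :=
  measurable_fun setT Z /\
  forall A : set R, measurable A -> P (Z @^-1` A) = gauss_law v A.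

Definition is_gauss_vec d (T : measurableType d) (P : probability T R) (k : nat)
  (Z : T -> 'cV[R]_k) (Sigma : 'M[R]_k) : Prop :=
  forall a : 'cV[R]_k,
    has_gauss_law P (fun w => (a^T *m Z w) 0 0) ((a^T *m Sigma *m a) 0 0).

Definition sqnorm_n (n : nat) (v : 'cV[R]_n) : R :=
  (\sum_(i < n) v i 0 ^+ 2) / n%:R.

Definition sup_norm (k : nat) (v : 'cV[R]_k) : R :=
  \big[Num.max/0]_(i < k) `|v i 0|.

Definition restr (p : nat) (S : {set 'I_p}) (b : 'cV[R]_p) : 'cV[R]_p :=
  \col_i (if i \in S then b i 0 else 0).

Definition subvec (p : nat) (S : {set 'I_p}) (b : 'cV[R]_p) : 'cV[R]_#|S| :=
  rowsub (fun k : 'I_#|S| => enum_val k) b.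

Definition subcols (n p : nat) (S : {set 'I_p}) (X : 'M[R]_(n, p)) : 'M[R]_(n, #|S|) :=
  colsub (fun k : 'I_#|S| => enum_val k) X.

Definition embed (p : nat) (S : {set 'I_p}) (u : 'cV[R]_#|S|) : 'cV[R]_p :=
  \sum_(k < #|S|) u k 0 *: delta_mx (enum_val k) 0.

Definition is_norm (p : nat) (N : 'cV[R]_p -> R) : Prop :=
  (forall x, 0 <= N x) /\ (forall x, N x = 0 -> x = 0) /\
  (forall (a : R) x, N (a *: x) = `|a| * N x) /\
  (forall x y, N (x + y) <= N x + N y).

Definition supp_in (p : nat) (S : {set 'I_p}) (x : 'cV[R]_p) : Prop :=
  forall i, i \notin S -> x i 0 = 0.

(* N is a norm on the coordinate subspace R^{S} (vectors supported in S),
   i.e. a norm on R^{|S|} *)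
Definition is_norm_on (p : nat) (S : {set 'I_p}) (N : 'cV[R]_p -> R) : Prop :=
  (forall x, supp_in S x -> 0 <= N x) /\
  (forall x, supp_in S x -> N x = 0 -> x = 0) /\
  (forall (a : R) x, supp_in S x -> N (a *: x) = `|a| * N x) /\
  (forall x y, supp_in S x -> supp_in S y -> N (x + y) <= N x + N y).

Definition allowed_by (p : nat) (Om : 'cV[R]_p -> R) (S : {set 'I_p})
  (N : 'cV[R]_p -> R) : Prop :=
  is_norm_on (~: S) N /\
  forall b, Om (restr S b) + N (restr (~: S) b) <= Om b.

Definition allowed (p : nat) (Om : 'cV[R]_p -> R) (S : {set 'I_p}) : Prop :=
  exists N, allowed_by Om S N.

Definition Upsilon (p : nat) (Om : 'cV[R]_p -> R)
  (Omc : {set 'I_p} -> 'cV[R]_p -> R) (S : {set 'I_p}) (b : 'cV[R]_p) : R :=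
  Om (restr S b) + Omc S (restr (~: S) b).

Definition Bbar (p : nat) (Om : 'cV[R]_p -> R)
  (Omc : {set 'I_p} -> 'cV[R]_p -> R) : set 'cV[R]_p :=
  [set b | exists S, allowed Om S /\ Upsilon Om Omc S b <= 1].

Definition flip (p : nat) (J : {set 'I_p}) (b : 'cV[R]_p) : 'cV[R]_p :=
  restr J b - restr (~: J) b.

Definition conv (p : nat) (A : set 'cV[R]_p) : set 'cV[R]_p :=
  [set x | exists (m : nat) (w : 'I_m -> R) (v : 'I_m -> 'cV[R]_p),
     (forall i, 0 <= w i) /\ \sum_(i < m) w i = 1 /\
     (forall i, A (v i)) /\ x = \sum_(i < m) w i *: v i].

Definition Bg (p : nat) (Om : 'cV[R]_p -> R)
  (Omc : {set 'I_p} -> 'cV[R]_p -> R) (J : {set 'I_p}) : set 'cV[R]_p :=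
  conv (Bbar Om Omc `|` (flip J @` Bbar Om Omc)).

Definition gauge (p : nat) (B : set 'cV[R]_p) (x : 'cV[R]_p) : R :=
  inf [set t : R | 0 < t /\ exists y, B y /\ x = t *: y].

Definition gJ (p : nat) (Om : 'cV[R]_p -> R)
  (Omc : {set 'I_p} -> 'cV[R]_p -> R) (J : {set 'I_p}) : 'cV[R]_p -> R :=
  gauge (Bg Om Omc J).

Definition Psi (p : nat) (Om : 'cV[R]_p -> R)
  (Omc : {set 'I_p} -> 'cV[R]_p -> R) (J : {set 'I_p})
  (A : 'M[R]_(#|~: J|, #|J|)) : R :=
  \sum_(j < #|J|) gJ Om Omc J (embed (col j A)).

Definition is_psd_sqrt (k : nat) (A S : 'M[R]_k) : Prop :=
  S^T = S /\ (forall v : 'cV[R]_k, 0 <= (v^T *m S *m v) 0 0) /\ S *m S = A.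

Definition msqrt (k : nat) (A : 'M[R]_k) : 'M[R]_k :=
  xget 0 [set S | is_psd_sqrt A S].

Definition nuc (m k : nat) (A : 'M[R]_(m, k)) : R := \tr (msqrt (A^T *m A)).

End Defs.
Arguments Psi {R p} Om Omc J A.

(* Main.v *)
From Pilot Require Import Defs.
From HB Require Import structures.
From mathcomp Require Import all_boot all_order all_algebra.
From mathcomp Require Import all_classical all_reals all_analysis.
From mathcomp Require Import ring lra.
Import Order.TTheory GRing.Theory Num.Theory.
Local Open Scope classical_set_scope.
Local Open Scope ring_scope.

(** Expanding the definition of [bhat], the error splits into the Gaussian part
[W = K^-1 R^T eps / sigma0], with [K = (R^T R)^{1/2}], and the remainder
[- K^-1 R^T X_{J^c} (betahat - beta0)_{J^c} / sigma0].  The remainder is bounded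
by the optimality of [BJ]: the nuclear norm satisfies
[2 |A|_nuc <= tr (A^T A K^-1) + tr K], with equality at [A = R], so perturbing
[BJ] by [t u e_j^T] and letting [t] tend to [0] gives
[|(K^-1 R^T X_{J^c} u)_j| <= lamJ g(u)], without differentiating the nuclear
norm.  Finally [b_{J^c}] is the midpoint of [b] and [flip_J (- b)], hence
[g(b_{J^c}) <= Upsilon_S b] for every allowed [S]. *)

Set Implicit Arguments.
Unset Strict Implicit.

(** * Coordinate restriction, embedding and sign flips *)

Section CoordinateRestriction.
Context {R : realType} {p : nat}.
Implicit Types (S : {set 'I_p}) (b : 'cV[R]_p).

Lemma mulmx_subcols_split n (X : 'M[R]_(n, p)) S b :
  X *m b = subcols S X *m subvec S b + subcols (~: S) X *m subvec (~: S) b.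
Proof.
apply/matrixP => i j; rewrite !mxE (bigID (mem S)) /=; congr (_ + _).
  by rewrite big_enum_val; apply: eq_bigr => k _; rewrite !mxE.
under eq_bigl => k do rewrite -finset.in_setC.
by rewrite big_enum_val; apply: eq_bigr => k _; rewrite !mxE.
Qed.

Lemma embed_subvec S b : embed (subvec S b) = restr S b.
Proof.
rewrite /embed; under eq_bigr => k _ do rewrite mxE.
rewrite -(@big_enum_val _ _ _ _ (mem S) (fun i => b i 0 *: delta_mx i 0)) /=.
apply/matrixP => i j; rewrite summxE mxE (ord1 j).
case: ifP => iS.
  rewrite (bigD1 i) //= !mxE !eqxx mulr1 big1 ?addr0 // => k /andP[_ ki].
  by rewrite !mxE eq_sym (negbTE ki) mulr0.
rewrite big1 // => k kS; rewrite !mxE; case: eqP => [ik|]; last by rewrite mulr0.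
by rewrite ik kS in iS.
Qed.

Lemma embedD S (u v : 'cV[R]_#|S|) : embed (u + v) = embed u + embed v.
Proof.
by rewrite /embed -big_split; apply: eq_bigr => k _; rewrite mxE scalerDl.
Qed.

Lemma embedZ S (a : R) (u : 'cV[R]_#|S|) : embed (a *: u) = a *: embed u.
Proof.
by rewrite /embed scaler_sumr; apply: eq_bigr => k _; rewrite mxE scalerA.
Qed.

Lemma restrZ S (a : R) b : restr S (a *: b) = a *: restr S b.
Proof. by apply/matrixP => i j; rewrite !mxE; case: ifP; rewrite ?mulr0. Qed.

Lemma restr_supp_in S b : supp_in S (restr S b).
Proof. by move=> i /negbTE iS; rewrite mxE iS. Qed.

Lemma flipZ S (a : R) b : flip S (a *: b) = a *: flip S b.
Proof. by rewrite /flip !restrZ scalerBr. Qed.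

Lemma restrC_flip S b : restr (~: S) b = 2^-1 *: b + 2^-1 *: flip S (- b).
Proof.
apply/matrixP => i j; rewrite !mxE finset.in_setC (ord1 j).
by case: (i \in S) => /=; field.
Qed.

End CoordinateRestriction.

Local Notation conv := Pilot.Defs.conv.

(** * Gauges of convex hulls *)

Section Gauge.
Context {R : realType} {p : nat}.
Implicit Types (A B : set 'cV[R]_p) (x y : 'cV[R]_p).

Lemma conv_convex A x y (t : R) : 0 <= t -> t <= 1 ->
  conv A x -> conv A y -> conv A (t *: x + (1 - t) *: y).
Proof.
move=> t0 t1 [m [w [v [w0 [w1 [Av ->]]]]]] [m' [w' [v' [w'0 [w'1 [Av' ->]]]]]].
exists (m + m')%N.
exists (fun i => match fintype.split i with inl k => t * w k | inr k => (1 - t) * w' k end).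
exists (fun i => match fintype.split i with inl k => v k | inr k => v' k end).
have sl (k : 'I_m) : fintype.split (lshift m' k) = inl k := unsplitK (inl k).
have sr (k : 'I_m') : fintype.split (rshift m k) = inr k := unsplitK (inr k).
split; first by move=> i; case: fintype.split => k; rewrite mulr_ge0 // subr_ge0.
split.
  rewrite big_split_ord /=; under eq_bigr do rewrite sl.
  under [X in _ + X]eq_bigr do rewrite sr.
  by rewrite -!mulr_sumr w1 w'1; ring.
split; first by move=> i; case: fintype.split => k.
rewrite big_split_ord /=; under [in RHS]eq_bigr do rewrite sl -scalerA.
under [X in _ = _ + X]eq_bigr do rewrite sr -scalerA.
by rewrite -!scaler_sumr.
Qed.

Lemma sub_conv A : A `<=` conv A.
Proof.
move=> x Ax; exists 1%N, (fun=> 1), (fun=> x); split => [_|]; first exact: ler01.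
by split; [rewrite big_ord1|split => //; rewrite big_ord1 scale1r].
Qed.

Lemma gauge_ge0 B x : 0 <= gauge B x.
Proof.
rewrite /gauge; set G := [set t | _].
(* If no positive multiple of [B] reaches [x], then [G] is empty and its [inf] is 0 by default. *)
have [[t Gt]|/set0P/negP/negPn/eqP ->] := pselect (G !=set0); last by rewrite inf0.
by apply: lb_le_inf; [exists t|move=> s [/ltW]].
Qed.

Lemma gauge_le B y (t : R) : 0 < t -> B y -> gauge B (t *: y) <= t.
Proof.
move=> t0 By; apply: ge_inf; first by exists 0 => s [/ltW].
by split => //; exists y.
Qed.

(** Makes the set of admissible scalings nonempty, so that the [inf] in [gauge] is a genuine
    infimum. *)
Definition absorbing B :=
  forall x, exists t : R, 0 < t /\ exists y, B y /\ x = t *: y.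

(** If [x] is [t] times and [y] is [s] times a point of the hull, then [x + y] is [t + s] times
    their convex combination with weights [t / (t + s)] and [s / (t + s)]. The two infima are taken
    one after the other. *)
Lemma gaugeD A x y : absorbing (conv A) ->
  gauge (conv A) (x + y) <= gauge (conv A) x + gauge (conv A) y.
Proof.
move=> absA; rewrite -lerBlDr; apply: lb_le_inf; first exact: absA.
move=> t [t0 [x' [Ax' ->]]]; rewrite lerBlDr -lerBlDl.
apply: lb_le_inf; first exact: absA.
move=> s [s0 [y' [Ay' ->]]]; rewrite lerBlDl.
have ts0 : 0 < t + s by rewrite addr_gt0.
have tsN : t + s != 0 by rewrite gt_eqF.
have -> : t *: x' + s *: y' =
    (t + s) *: (t / (t + s) *: x' + (1 - t / (t + s)) *: y').
  by rewrite scalerDr !scalerA; congr (_ *: _ + _ *: _); field.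
apply: gauge_le => //; apply: conv_convex => //.
  by rewrite divr_ge0 // ltW.
by rewrite ler_pdivrMr // mul1r lerDl ltW.
Qed.

Lemma gaugeZ_le B x (a : R) : absorbing B -> 0 < a ->
  gauge B (a *: x) <= a * gauge B x.
Proof.
move=> absB a0; rewrite -ler_pdivrMl //; apply: lb_le_inf; first exact: absB.
move=> t [t0 [y [By ->]]]; rewrite ler_pdivrMl // scalerA.
by apply: gauge_le => //; rewrite mulr_gt0.
Qed.

Lemma gaugeN A x : (forall y, A y -> A (- y)) ->
  gauge (conv A) (- x) = gauge (conv A) x.
Proof.
move=> symA.
have symC y : conv A y -> conv A (- y).
  move=> [m [w [v [w0 [w1 [Av ->]]]]]]; exists m, w, (fun i => - v i).
  split => //; split => //; split => [i|]; first exact: symA.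
  by rewrite -sumrN; apply: eq_bigr => i _; rewrite scalerN.
congr inf; apply/seteqP; split => t [t0 [y [Cy xy]]]; split => //;
  exists (- y); (split; first exact: symC).
  by rewrite scalerN -xy opprK.
by rewrite scalerN -xy.
Qed.

End Gauge.

(** * The gauge [gJ] under weak decomposability *)

Section WeakDecomposability.
Context {R : realType} {p : nat}.
Variables (Om : 'cV[R]_p -> R) (Omc : {set 'I_p} -> 'cV[R]_p -> R).
Hypothesis Om_norm : is_norm Om.
Hypothesis Omc_norm : forall S, allowed Om S -> allowed_by Om S (Omc S).
Variable (J : {set 'I_p}).

Lemma UpsilonZ S (a : R) b : allowed Om S ->
  Upsilon Om Omc S (a *: b) = `|a| * Upsilon Om Omc S b.
Proof.
move=> /Omc_norm[[_ [_ [OmcZ _]]] _]; have [_ [_ [OmZ _]]] := Om_norm.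
by rewrite /Upsilon !restrZ OmZ OmcZ ?mulrDr //; exact: restr_supp_in.
Qed.

Lemma Upsilon_ge0 S b : allowed Om S -> 0 <= Upsilon Om Omc S b.
Proof.
move=> /Omc_norm[[Omc0 _] _]; have [Om0 _] := Om_norm.
by rewrite addr_ge0 // Omc0 //; exact: restr_supp_in.
Qed.

Lemma BbarN b : Bbar Om Omc b -> Bbar Om Omc (- b).
Proof.
move=> [S [aS Sb]]; exists S; split => //.
by rewrite -scaleN1r UpsilonZ // normrN1 mul1r.
Qed.

Lemma Bbar_scale S b (t : R) : allowed Om S -> 0 < t -> Upsilon Om Omc S b <= t ->
  Bbar Om Omc (t^-1 *: b).
Proof.
move=> aS t0 bt; exists S; split => //.
by rewrite UpsilonZ // gtr0_norm ?invr_gt0 // ler_pdivrMl // mulr1.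
Qed.

Lemma Bg_absorbing S : allowed Om S -> absorbing (Bg Om Omc J).
Proof.
move=> aS x; have U0 := Upsilon_ge0 x aS.
(* Adding 1 keeps the scaling factor positive even where [Upsilon] vanishes. *)
have t0 : 0 < Upsilon Om Omc S x + 1 by rewrite ltr_wpDl.
exists (Upsilon Om Omc S x + 1); split => //.
exists ((Upsilon Om Omc S x + 1)^-1 *: x); split.
  by apply: sub_conv; left; apply: (Bbar_scale aS) => //; rewrite lerDl.
by rewrite scalerA divff ?scale1r // gt_eqF.
Qed.

Lemma gJN x : gJ Om Omc J (- x) = gJ Om Omc J x.
Proof.
apply: gaugeN => y [By|[z Bz <-]]; first by left; exact: BbarN.
by right; exists (- z); [exact: BbarN|rewrite -scaleN1r flipZ scaleN1r].
Qed.

(* The restriction to J^c is the midpoint of b and flip_J (- b). *)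
Lemma gJ_restrC_le S b : allowed Om S ->
  gJ Om Omc J (restr (~: J) b) <= Upsilon Om Omc S b.
Proof.
(* The slack [e] makes [t] positive, so [b] can be rescaled into [Bbar] even if [Upsilon] vanishes
   at [b]. *)
move=> aS; apply/ler_addgt0Pl => e e0; set t := e + _.
have bt : Upsilon Om Omc S b <= t by rewrite lerDr ltW.
have t0 : 0 < t by rewrite ltr_wpDr // Upsilon_ge0.
have Bb := Bbar_scale aS t0 bt.
have -> : restr (~: J) b = t *: restr (~: J) (t^-1 *: b).
  by rewrite restrZ scalerA divff ?scale1r // gt_eqF.
apply: gauge_le => //; rewrite restrC_flip.
rewrite [X in _ + X *: _](_ : _ = 1 - 2^-1); last by field.
apply: conv_convex; [lra|lra|by apply: sub_conv; left|apply: sub_conv; right].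
by exists (- (t^-1 *: b)) => //; exact: BbarN.
Qed.

(** Only column [j] changes, by [t *: u], and the gauge is sublinear. *)
Lemma Psi_rank1_le S (B : 'M[R]_(#|~: J|, #|J|)) (u : 'cV[R]_#|~: J|) j (t : R) :
  allowed Om S -> 0 < t ->
  Psi Om Omc J (B + t *: (u *m delta_mx (0 : 'I_1) j)) <=
  Psi Om Omc J B + t * gJ Om Omc J (embed u).
Proof.
move=> aS t0; have abs := Bg_absorbing aS.
have colE k : col k (B + t *: (u *m delta_mx (0 : 'I_1) j)) =
    col k B + (if k == j then t *: u else 0).
  apply/matrixP => i l; rewrite !mxE big_ord1 !mxE (ord1 l) eqxx /=.
  by case: (k == j); rewrite !mxE ?mulr1 ?mulr0.
rewrite /Psi (bigD1 j) //= [X in _ <= X + _](bigD1 j) //= addrAC lerD //.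
  rewrite colE eqxx embedD embedZ (le_trans (gaugeD _ _ abs)) //.
  by rewrite lerD2l gaugeZ_le.
by apply: ler_sum => k kj; rewrite colE (negbTE kj) addr0.
Qed.

End WeakDecomposability.

(** * Trace bounds for the nuclear norm *)

Section NuclearNorm.
Context {R : realType}.

Lemma mxtrace_psd_ge0 k (A : 'M[R]_k) :
  (forall v : 'cV[R]_k, 0 <= (v^T *m A *m v) 0 0) -> 0 <= \tr A.
Proof.
move=> A0; apply: sumr_ge0 => i _; have := A0 (delta_mx i 0).
by rewrite trmx_delta -rowE -colE !mxE.
Qed.

Lemma is_psd_sqrt_unitmx k (A K : 'M[R]_k) :
  A \in unitmx -> is_psd_sqrt A K -> K \in unitmx.
Proof. by move=> uA [_ [_ AE]]; move: uA; rewrite -AE unitmx_mul => /andP[]. Qed.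

(** The form of [K^-1] at [v] is the form of [K] at [K^-1 v]. *)
Lemma invmx_psd k (K : 'M[R]_k) (v : 'cV[R]_k) : K \in unitmx -> K^T = K ->
  (forall v : 'cV[R]_k, 0 <= (v^T *m K *m v) 0 0) ->
  0 <= (v^T *m invmx K *m v) 0 0.
Proof.
move=> uK Ks K0; have := K0 (invmx K *m v).
by rewrite trmx_mul trmx_inv Ks mulmxA mulmxKV.
Qed.

(* The trace of (Q - K) K^-1 (Q - K) is nonnegative. *)
Lemma mxtrace_psd_sqrt_le k (G A Q K : 'M[R]_k) :
  A \in unitmx -> is_psd_sqrt A K -> is_psd_sqrt G Q ->
  2 * \tr Q <= \tr (G *m invmx K) + \tr K.
Proof.
move=> uA sK [Qs [_ <-]]; have uK := is_psd_sqrt_unitmx uA sK.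
have [Ks [K0 _]] := sK.
have : 0 <= \tr ((Q - K) *m invmx K *m (Q - K)).
  apply: mxtrace_psd_ge0 => v; have := @invmx_psd _ K ((Q - K) *m v) uK Ks K0.
  by rewrite trmx_mul linearB /= Qs Ks !mulmxA.
(* The product expands to [Q K^-1 Q - 2 Q + K]; by cyclicity and [Q Q = G] the first term has trace
   [tr (G K^-1)]. *)
rewrite mulmxBl mulmxV // mulmxBr !mulmxBl mulmxKV // !mul1mx !linearB /=.
by rewrite [\tr (Q *m _ *m Q)]mxtrace_mulC mulmxA; lra.
Qed.

(** [msqrt] falls back on 0 when no root exists, so a nonzero value certifies a root. *)
Lemma is_psd_sqrt_msqrt k (A : 'M[R]_k) :
  msqrt A != 0 -> is_psd_sqrt A (msqrt A).
Proof. by rewrite /msqrt; case: xgetP => [Q -> //|_]; rewrite eqxx. Qed.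

Lemma is_psd_sqrt_msqrt_ex k (A Q : 'M[R]_k) :
  is_psd_sqrt A Q -> is_psd_sqrt A (msqrt A).
Proof. by move=> sQ; rewrite /msqrt; case: xgetP => [Q' -> //|/(_ Q)]. Qed.

Lemma is_psd_sqrtZ k (A Q : 'M[R]_k) (a : R) : 0 <= a ->
  is_psd_sqrt A Q -> is_psd_sqrt (a ^+ 2 *: A) (a *: Q).
Proof.
move=> a0 [Qs [Q0 <-]]; split; first by rewrite linearZ /= Qs.
split; last by rewrite -scalemxAl -scalemxAr scalerA.
by move=> v; rewrite -scalemxAr -scalemxAl mxE mulr_ge0.
Qed.

(* If A^T A had no square root, msqrt would return the junk value 0 and the
   bound would hold trivially. *)
Lemma nuc_le m k (A : 'M[R]_(m, k)) (G K : 'M[R]_k) :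
  G \in unitmx -> is_psd_sqrt G K ->
  2 * nuc A <= \tr (A^T *m A *m invmx K) + \tr K.
Proof.
move=> uG sK; have [Q0|/is_psd_sqrt_msqrt sQ] := eqVneq (msqrt (A^T *m A)) 0; last first.
  exact: mxtrace_psd_sqrt_le uG sK sQ.
have [Ks [K0 _]] := sK; have uK := is_psd_sqrt_unitmx uG sK.
rewrite /nuc Q0 mxtrace0 mulr0 addr_ge0 //; last exact: mxtrace_psd_ge0.
rewrite -mulmxA mxtrace_mulC; apply: mxtrace_psd_ge0 => v.
have := @invmx_psd _ K (A^T *m v) uK Ks K0.
by rewrite trmx_mul trmxK !mulmxA.
Qed.

(** Any two roots have equal traces: for two roots of one matrix the right-hand side of
    [mxtrace_psd_sqrt_le] is twice a trace, and the roles can be swapped. *)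
Lemma nuc_eq m k (A : 'M[R]_(m, k)) (K : 'M[R]_k) :
  A^T *m A \in unitmx -> is_psd_sqrt (A^T *m A) K -> nuc A = \tr K.
Proof.
move=> uA sK; have sQ := is_psd_sqrt_msqrt_ex sK.
have tr_le Q Q' : is_psd_sqrt (A^T *m A) Q -> is_psd_sqrt (A^T *m A) Q' ->
    \tr Q <= \tr Q'.
  move=> s s'; have := mxtrace_psd_sqrt_le uA s' s.
  have uQ' := is_psd_sqrt_unitmx uA s'.
  by have [_ [_ <-]] := s'; rewrite mulmxK //; lra.
by apply/eqP; rewrite eq_le !tr_le.
Qed.


(* Since K realises equality in nuc_le at A, that bound, which is quadratic in
   t, majorises t |-> nuc (A - t V) and touches it at t = 0. *)
Lemma nuc_perturb_le m k (A V : 'M[R]_(m, k)) (K : 'M[R]_k) (t : R) :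
  A^T *m A \in unitmx -> is_psd_sqrt (A^T *m A) K ->
  nuc (A - t *: V) <= nuc A - t * \tr (invmx K *m A^T *m V)
                      + t ^+ 2 * (\tr (V^T *m V *m invmx K) / 2).
Proof.
move=> uA sK; have uK := is_psd_sqrt_unitmx uA sK.
have := nuc_le (A - t *: V) uA sK; rewrite (nuc_eq uA sK).
have [Ks [_ KK]] := sK.
have -> : (A - t *: V)^T *m (A - t *: V) =
    A^T *m A - t *: (V^T *m A + A^T *m V) + t ^+ 2 *: (V^T *m V).
  rewrite [(A - _)^T]linearB /= [(t *: V)^T]linearZ /= mulmxBl !mulmxBr -!scalemxAl -!scalemxAr scalerDr.
  by rewrite scalerA opprB !opprD !addrA addrAC [_ - _ - t *: (A^T *m V)]addrAC.
rewrite !mulmxDl mulNmx -!scalemxAl mulmxDl !mxtraceD.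
rewrite [\tr (- _)]raddfN /= !mxtraceZ mxtraceD.
(* The two cross terms have the same trace: this one by transposition and symmetry of [K], the next
   by cyclicity. *)
have -> : \tr (V^T *m A *m invmx K) = \tr (invmx K *m A^T *m V).
  by rewrite -mxtrace_tr !trmx_mul trmx_inv Ks trmxK mulmxA.
have -> : \tr (A^T *m V *m invmx K) = \tr (invmx K *m A^T *m V).
  by rewrite mxtrace_mulC mulmxA.
by rewrite -KK mulmxK //; nra.
Qed.

End NuclearNorm.

(** * First-order optimality of the nuclear norm minimizer *)

Lemma first_order_le (R : realFieldType) (a b c : R) :
  (forall t, 0 < t -> t * a <= t * b + t ^+ 2 * c) -> a <= b.
Proof.
move=> le_ab; apply/ler_addgt0Pl => e e0; have c0 : 0 < `|c| + 1 by rewrite ltr_wpDl.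
(* With this [t], the quadratic term divided by [t] is at most [e]. *)
have := le_ab (e / (`|c| + 1)) (divr_gt0 e0 c0).
rewrite expr2 -mulrA -mulrDr ler_pM2l ?divr_gt0 // => /le_trans; apply.
rewrite addrC lerD2r (le_trans (ler_norm _)) // normrM gtr0_norm ?divr_gt0 //.
by rewrite mulrAC ler_pdivrMr // ler_pM2l // lerDl.
Qed.

(* The KKT conditions of the nuclear norm problem, tested against the rank-one
   perturbations u e_j^T. *)
Lemma nuc_minimizer_residual_le (R : realType) (n p : nat) (X : 'M[R]_(n, p))
    (Om : 'cV[R]_p -> R) (Omc : {set 'I_p} -> 'cV[R]_p -> R) (J S : {set 'I_p})
    (lamJ : R) (BJ : 'M[R]_(#|~: J|, #|J|)) (K : 'M[R]_#|J|)
    (Rm := subcols J X - subcols (~: J) X *m BJ) :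
  is_norm Om -> (forall S, allowed Om S -> allowed_by Om S (Omc S)) ->
  allowed Om S -> 0 < lamJ ->
  (forall B : 'M[R]_(#|~: J|, #|J|),
     nuc Rm + lamJ * Psi Om Omc J BJ
     <= nuc (subcols J X - subcols (~: J) X *m B) + lamJ * Psi Om Omc J B) ->
  Rm^T *m Rm \in unitmx -> is_psd_sqrt (Rm^T *m Rm) K ->
  forall (u : 'cV[R]_#|~: J|) j,
    `|(invmx K *m Rm^T *m (subcols (~: J) X *m u)) j 0|
    <= lamJ * gJ Om Omc J (embed u).
Proof.
move=> OmN OmcN aS lamJ0 minBJ uR sK.
(* The one-sided bound suffices: applied to [- u], it gives the other side because [gJ] is even. *)
have upper (u : 'cV[R]_#|~: J|) j :
    (invmx K *m Rm^T *m (subcols (~: J) X *m u)) j 0 <= lamJ * gJ Om Omc J (embed u).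
  set V := subcols (~: J) X *m (u *m delta_mx (0 : 'I_1) j).
  have trE : \tr (invmx K *m Rm^T *m V) =
      (invmx K *m Rm^T *m (subcols (~: J) X *m u)) j 0.
    rewrite /V !mulmxA mxtrace_mulC -rowE trace_mx11 mxE.
    by rewrite -!mulmxA.
  apply: (@first_order_le _ _ _ (\tr (V^T *m V *m invmx K) / 2)) => t t0.
  have := minBJ (BJ + t *: (u *m delta_mx (0 : 'I_1) j)).
  have -> : subcols J X - subcols (~: J) X *m (BJ + t *: (u *m delta_mx (0 : 'I_1) j))
      = Rm - t *: V.
    by rewrite mulmxDr -scalemxAr opprD addrA.
  have := nuc_perturb_le V t uR sK; rewrite trE.
  have := Psi_rank1_le OmN OmcN BJ u j aS t0; rewrite -(ler_pM2l lamJ0).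
  by lra.
move=> u j; rewrite ler_norml upper andbT lerNl.
have := upper (- u) j; rewrite !mulmxN mxE.
by rewrite -(scaleN1r u) embedZ scaleN1r gJN.
Qed.

(** * Gaussian part and remainder of the estimator *)

Lemma is_gauss_vec_mulmx (R : realType) (d : measure_display) (T : measurableType d)
    (P : probability T R) (n k : nat) (Z : T -> 'cV[R]_n) (Sigma : 'M[R]_n)
    (A : 'M[R]_(k, n)) :
  is_gauss_vec P Z Sigma ->
  is_gauss_vec P (fun w => A *m Z w) (A *m Sigma *m A^T).
Proof.
by move=> gZ a; have := gZ (A^T *m a); rewrite trmx_mul trmxK !mulmxA;
  under [X in has_gauss_law _ X]eq_fun do rewrite -mulmxA.
Qed.

Theorem theorem1 (R : realType) (d : measure_display) (T : measurableType d)
  (P : probability T R) (n p : nat) (X : 'M[R]_(n, p)) (beta0 : 'cV[R]_p)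
  (sigma0 : R) (eps : T -> 'cV[R]_n)
  (Om : 'cV[R]_p -> R) (Omc : {set 'I_p} -> 'cV[R]_p -> R)
  (lam : R) (betahat : T -> 'cV[R]_p)
  (J : {set 'I_p}) (lamJ : R) (BJ : 'M[R]_(#|~: J|, #|J|))
  (Sstar : {set 'I_p}) :
  (0 < n)%N -> 0 < sigma0 ->
  is_gauss_vec P eps (sigma0 ^+ 2 *: 1%:M) ->
  is_norm Om ->
  (forall S, allowed Om S -> allowed_by Om S (Omc S)) ->
  0 < lam ->
  (forall w b,
     sqnorm_n (X *m beta0 + eps w - X *m betahat w) + lam * Om (betahat w)
     <= sqnorm_n (X *m beta0 + eps w - X *m b) + lam * Om b) ->
  0 < lamJ ->
  (forall B : 'M[R]_(#|~: J|, #|J|),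
     nuc (subcols J X - subcols (~: J) X *m BJ) + lamJ * Psi Om Omc J BJ
     <= nuc (subcols J X - subcols (~: J) X *m B) + lamJ * Psi Om Omc J B) ->
  let Rm := subcols J X - subcols (~: J) X *m BJ in
  let SigmaJ := n%:R^-1 *: (Rm^T *m Rm) in
  let TJ := n%:R^-1 *: (Rm^T *m subcols J X) in
  nuc Rm != 0 -> SigmaJ \in unitmx -> TJ \in unitmx ->
  allowed Om Sstar ->
  let M := Num.sqrt n%:R *: (invmx (msqrt SigmaJ) *m TJ) in
  let bhat := fun w => subvec J (betahat w)
     + invmx TJ *m (n%:R^-1 *: (Rm^T *m (X *m beta0 + eps w - X *m betahat w)))
  in
  exists W : T -> 'cV[R]_#|J|,
    is_gauss_vec P W 1%:M /\
    forall w,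
      let rem := sigma0^-1 *: (M *m (bhat w - subvec J beta0)) - W w in
      sup_norm rem
        <= Num.sqrt n%:R * lamJ
           * gJ Om Omc J (restr (~: J) (betahat w - beta0)) / sigma0
      /\ Num.sqrt n%:R * lamJ
           * gJ Om Omc J (restr (~: J) (betahat w - beta0)) / sigma0
        <= Num.sqrt n%:R * lamJ * Upsilon Om Omc Sstar (betahat w - beta0) / sigma0.
Proof.
move=> n0 sigma0_gt0 gauss_eps OmN OmcN lam0 minbeta lamJ0 minBJ Rm SigmaJ TJ nucR
  uSigma uT aS M bhat.
have nR0 : 0 < n%:R :> R by rewrite ltr0n.
have rn0 : 0 < Num.sqrt n%:R :> R by rewrite sqrtr_gt0.
have rn2 : Num.sqrt n%:R ^+ 2 = n%:R :> R by rewrite sqr_sqrtr // ltW.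
have rn1 : 1 <= Num.sqrt n%:R :> R by rewrite -{1}(@sqrtr1 R) ler_wsqrtr // ler1n.
set rn := Num.sqrt n%:R in rn0 rn2 rn1 M *.
have uR : Rm^T *m Rm \in unitmx.
  by move: uSigma; rewrite unitmxZ // unitfE invr_eq0 gt_eqF.
(* The nonzero nuclear norm rules out the default value 0 of [msqrt]; a root of [SigmaJ] then
   follows by rescaling. *)
have sQ : is_psd_sqrt (Rm^T *m Rm) (msqrt (Rm^T *m Rm)).
  apply: is_psd_sqrt_msqrt; apply: contraNneq nucR => Q0.
  by rewrite /nuc Q0 mxtrace0.
have sS : is_psd_sqrt SigmaJ (msqrt SigmaJ).
  have rnV : 0 <= rn^-1 by rewrite invr_ge0 ltW.
  by have /is_psd_sqrt_msqrt_ex := is_psd_sqrtZ rnV sQ; rewrite exprVn rn2.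
set S := msqrt SigmaJ in sS M *.
have uS : S \in unitmx := is_psd_sqrt_unitmx uSigma sS.
have sK : is_psd_sqrt (Rm^T *m Rm) (rn *: S).
  have := is_psd_sqrtZ (ltW rn0) sS.
  by rewrite rn2 scalerA divff ?scale1r // gt_eqF.
have uK := is_psd_sqrt_unitmx uR sK.
have [Ss [_ SS]] := sS.
(* [C] is the matrix applied to [eps] in the normalized error: [M] cancels the inverse of [TJ], and
   [rn / n] becomes [rn^-1]. *)
pose C := sigma0^-1 *: (invmx (rn *: S) *m Rm^T).
have CE : C = (sigma0^-1 * rn^-1) *: (invmx S *m Rm^T).
  by rewrite /C invmxZ // -scalemxAl scalerA.
exists (fun w => C *m eps w); split.
  have := is_gauss_vec_mulmx C gauss_eps.
  (* With [K = rn *: S], the covariance is [K^-1 R^T R K^-1 = K^-1 K K K^-1]. *)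
  suff -> : C *m (sigma0 ^+ 2 *: 1%:M) *m C^T = 1%:M by [].
  have [Ks [_ KK]] := sK.
  rewrite -scalemxAr mulmx1 -scalemxAl /C linearZ /= -scalemxAr -scalemxAl !scalerA.
  rewrite trmx_mul trmxK trmx_inv Ks -mulmxA (mulmxA Rm^T) -KK mulmxK //.
  by rewrite mulVmx // -expr2 -exprMn divff ?gt_eqF // expr1n scale1r.
move=> w rem; set delta := betahat w - beta0.
have g0 := gauge_ge0 (Bg Om Omc J) (restr (~: J) delta).
have remE : rem = - (C *m (subcols (~: J) X *m subvec (~: J) delta)).
  have XD : X *m beta0 + eps w - X *m betahat w = eps w - X *m delta.
    by rewrite /delta mulmxBr opprB addrA [eps w + _]addrC.
  have subD : subvec J (betahat w) - subvec J beta0 = subvec J delta.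
    by apply/matrixP => i j; rewrite !mxE.
  (* Splitting [X *m delta] over [J] and its complement, the [J] part cancels against
     [TJ *m subvec J delta]. *)
  have TE : TJ *m (bhat w - subvec J beta0) = n%:R^-1 *:
      (Rm^T *m eps w - Rm^T *m (subcols (~: J) X *m subvec (~: J) delta)).
    rewrite /bhat XD addrAC subD mulmxDr mulKVmx // /TJ -scalemxAl.
    rewrite -scalerDr -mulmxA -mulmxDr (mulmx_subcols_split X J) -mulmxBr.
    by rewrite opprD addrCA addNKr.
  rewrite /rem /M -scalemxAl -mulmxA TE CE -!scalemxAr !scalerA mulmxBr scalerBr.
  have -> : sigma0^-1 * rn * n%:R^-1 = sigma0^-1 * rn^-1.
    by rewrite -rn2; field; rewrite !gt_eqF.
  by rewrite -!scalemxAl !mulmxA addrAC subrr add0r.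
split; last first.
  rewrite ler_pM2r ?invr_gt0 // ler_pM2l ?mulr_gt0 //.
  exact: gJ_restrC_le.
(* [sup_norm] is a maximum started at 0, so the bound itself must be shown nonnegative. *)
apply: bigmax_le => [|j _].
  by rewrite !mulr_ge0 // ?invr_ge0 ltW.
rewrite remE -scalemxAl !mxE normrN normrM gtr0_norm ?invr_gt0 // mulrC ler_pM2r ?invr_gt0 //.
have := nuc_minimizer_residual_le OmN OmcN aS lamJ0 minBJ uR sK (subvec (~: J) delta) j.
rewrite embed_subvec mxE => /le_trans; apply.
(* The optimality bound carries no factor [rn]; it is inserted here using [1 <= rn]. *)
by rewrite -mulrA ler_peMl // mulr_ge0 // ltW.
Qed.
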